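(* Let $n,k$ be positive integers and let $\alpha=(\alpha_1,\ldots,\alpha_k)$ be integers with $n\ge\alpha_1\ge\alpha_2\ge\cdots\ge\alpha_k\ge 0$. Define the sets of cells (cell $(i,j)$ lies in row $i$ and column $j$; rows numbered from bottom to top, columns from left to right) $$T=\{(i,j)\mid 1\le i\le k,\ \alpha_1-\alpha_i+1\le j\le n+\alpha_1-\alpha_i\},$$ $$T^*=\{(i,j)\mid 1\le i\le k,\ \alpha_{k-i+1}-\alpha_k+1\le j\le n+\alpha_{k-i+1}-\alpha_k\},$$ so that $T^*$ is (a translate of) the rotation of $T$ through 180 degrees. Then, as multisets, $$AL(T)=AL(T^* ).$$
   Context: For a finite set of cells $G$ (a skew diagram) and a cell $x\in G$: the arm length $a_G(x)$ is the number of cells of $G$ in the same row as $x$ and to the right of $x$; the leg length $l_G(x)$ is the number of cells of $G$ in the same column as $x$ and below $x$ (rows are numbered from bottom to top, so ''below'' means smaller row index). $AL(G)$ denotes the multiset $\{(a_G(x),l_G(x))\mid x\in G\}$ of arm–leg pairs over all cells of $G$. *)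

(* Defs.v *)
From mathcomp Require Import all_boot.
From mathcomp Require Import finmap multiset zify.

Set Implicit Arguments.
Unset Strict Implicit.
Unset Printing Implicit Defensive.

Local Open Scope fset_scope.
Local Open Scope mset_scope.
Local Open Scope nat_scope.

(* A pair [(i, j)] of type [nat * nat] is the cell in row [i] and column [j];
   rows are numbered from bottom to top, columns from left to right. *)

Definition arm (G : {fset nat * nat}) (x : nat * nat) : nat :=
  #|` [fset y in G | (y.1 == x.1) && (x.2 < y.2)] |.

Definition leg (G : {fset nat * nat}) (x : nat * nat) : nat :=
  #|` [fset y in G | (y.2 == x.2) && (y.1 < x.1)] |.

Definition AL (G : {fset nat * nat}) : {mset nat * nat} :=
  seq_mset [seq (arm G x, leg G x) | x <- enum_fset G].

(* In the two definitions below [alpha 1, ..., alpha k] are the relevant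
   values of [alpha]. When they are weakly decreasing every subtraction is
   exact: no truncation takes place. *)
Definition skewT (n k : nat) (alpha : nat -> nat) : {fset nat * nat} :=
  [fset (i, j) | i : nat in index_iota 1 k.+1,
                 j : nat in index_iota (alpha 1 - alpha i + 1)
                                 (n + (alpha 1 - alpha i)).+1].

Definition skewTstar (n k : nat) (alpha : nat -> nat) : {fset nat * nat} :=
  [fset (i, j) | i : nat in index_iota 1 k.+1,
                 j : nat in index_iota (alpha (k - i + 1) - alpha k + 1)
                                 (n + (alpha (k - i + 1) - alpha k)).+1].

Lemma mem_skewT n k alpha i j :
  ((i, j) \in skewT n k alpha) =
  (1 <= i <= k) &&
  (alpha 1 - alpha i + 1 <= j <= n + (alpha 1 - alpha i)).
Proof.
apply/imfset2P/andP => [[a /= + [b + [-> ->]]]|[hi hj]].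
  by rewrite !mem_index_iota !ltnS.
by exists i; [rewrite mem_index_iota ltnS|
  exists j; rewrite ?inE ?mem_index_iota ?ltnS].
Qed.

Lemma mem_skewTstar n k alpha i j :
  ((i, j) \in skewTstar n k alpha) =
  (1 <= i <= k) &&
  (alpha (k - i + 1) - alpha k + 1 <= j
     <= n + (alpha (k - i + 1) - alpha k)).
Proof.
apply/imfset2P/andP => [[a /= + [b + [-> ->]]]|[hi hj]].
  by rewrite !mem_index_iota !ltnS.
by exists i; [rewrite mem_index_iota ltnS|
  exists j; rewrite ?inE ?mem_index_iota ?ltnS].
Qed.

(* A half-turn of the bounding box [1, k] x [1, n + alpha 1 - alpha k] of
   [skewT n k alpha] takes it to [skewTstar n k alpha]. *)
Lemma skewTstar_rot n k alpha i j :
  (forall i, 1 <= i < k -> alpha i.+1 <= alpha i) ->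
  1 <= i <= k -> 1 <= j <= n + (alpha 1 - alpha k) ->
  ((i, j) \in skewTstar n k alpha) =
  ((k + 1 - i, n + (alpha 1 - alpha k) + 1 - j) \in skewT n k alpha).
Proof.
move=> hdec hi hj; rewrite mem_skewTstar mem_skewT.
have mono a d : 1 <= a -> a + d <= k -> alpha (a + d) <= alpha a.
  elim: d => [|d IHd] ha hk; first by rewrite addn0.
  rewrite addnS; apply: leq_trans (hdec _ _) (IHd _ _); lia.
have -> : k + 1 - i = k - i + 1 by lia.
have := mono 1 (k - i) isT; have := mono (k - i + 1) i.-1.
have -> : k - i + 1 + i.-1 = k by lia.
rewrite (addnC 1); lia.
Qed.

(* Main.v *)
Require Import Defs.
From mathcomp Require Import all_boot.
From mathcomp Require Import finmap multiset.
From mathcomp Require Import zify.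

(** Let [b i] be the horizontal shift of row [i]. The cell of row [i] with arm
    length [a] has leg length [#{i' < i | b i - b i' <= a}], and since [b] is
    nondecreasing this is at least [d > 0] iff [d < i] and
    [b i - b (i - d) <= a]. For fixed [a] and [d], the number of such [i] is the
    number of pairs of rows at distance [d] with shifts differing by at most
    [a], which a half-turn preserves. Hence for each [a] the leg lengths of the
    cells with arm length [a] have the same distribution in both diagrams. *)

Set Implicit Arguments.
Unset Strict Implicit.
Unset Printing Implicit Defensive.

Local Open Scope fset_scope.
Local Open Scope nat_scope.

(** The multiplicity of [d] is the number of entries at least [d] minus the number at least
    [d.+1]. *)
Lemma perm_eq_count_leq (s t : seq nat) :
  (forall d, count (leq d) s = count (leq d) t) -> perm_eq s t.
Proof.
have countE (u : seq nat) d :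
    count_mem d u + count (leq d.+1) u = count (leq d) u.
  by elim: u => //= x u <-; case: (ltngtP x d); lia.
move=> st; apply/allP => d _ /=; apply/eqP.
by have := countE s d; rewrite !st -(countE t d) => /addIn.
Qed.

(** The points of [p] form a final segment of [1..m], and [m.+1 - d] is the [d]-th point of [1..m]
    from the end. *)
Lemma leq_count_iota (p : pred nat) m d :
  (forall i j, 0 < i -> i <= j -> j <= m -> p i -> p j) -> 0 < d ->
  (d <= count p (iota 1 m)) = (d <= m) && p (m.+1 - d).
Proof.
move=> up d_gt0; have [le_dm|lt_md] /= := leqP d m; last first.
  by apply/negbTE; rewrite -ltnNge (leq_ltn_trans (count_size _ _)) ?size_iota.
have -> : iota 1 m = iota 1 (m - d) ++ (m.+1 - d) :: iota (m.+2 - d) d.-1.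
  have -> : m.+1 - d = 1 + (m - d) by lia.
  have -> : m.+2 - d = (1 + (m - d)).+1 by lia.
  rewrite -[_ :: _]/(iota (1 + (m - d)) d.-1.+1) -iotaD; congr iota; lia.
rewrite count_cat /=; have [pm|npm] := boolP (p _).
  have /eqP -> : count p (iota (m.+2 - d) d.-1) == d.-1.
    rewrite -[X in _ == X](size_iota (m.+2 - d)) -all_count.
    apply/allP => j; rewrite mem_iota => hj; apply: up pm; lia.
  lia.
have -> : count p (iota 1 (m - d)) = 0.
  apply/eqP; rewrite -leqn0 leqNgt -has_count; apply/hasPn => j.
  rewrite mem_iota => hj; apply: contra npm; apply: up; lia.
by have := count_size p (iota (m.+2 - d) d.-1); rewrite size_iota; lia.
Qed.

Section Shifted.
Variables (n k : nat) (b : nat -> nat).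
Hypothesis b_mono : forall i j, 0 < i -> i <= j -> j <= k -> b i <= b j.

Definition shifted_rows : {fset nat * nat} :=
  [fset (i, j) | i : nat in index_iota 1 k.+1,
                 j : nat in index_iota (b i + 1) (n + b i).+1].

(** The leg length of the cell of row [i] with arm length [a], which lies in column [b i + n - a]:
    the inequality says that row [i'] extends that far to the right. *)
Definition row_leg (a i : nat) : nat :=
  count (fun i' => b i <= b i' + a) (iota 1 i.-1).

Lemma mem_shifted_rows i j :
  ((i, j) \in shifted_rows) = (1 <= i <= k) && (b i + 1 <= j <= n + b i).
Proof.
apply/imfset2P/andP => [[c /= + [d + [-> ->]]]|[hi hj]].
  by rewrite !mem_index_iota !ltnS.
by exists i; [rewrite mem_index_iota ltnS|
  exists j; rewrite ?inE ?mem_index_iota ?ltnS].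
Qed.

(** Row [i] ends in column [b i + n], so [a] is the arm length; it is listed outermost so that leg
    lengths can be compared for each fixed [a]. *)
Lemma perm_shifted_rows :
  perm_eq (enum_fset shifted_rows)
          [seq (i, b i + n - a) | a <- iota 0 n, i <- iota 1 k].
Proof.
apply: uniq_perm => [||[i j]]; first exact: fset_uniq.
  apply: allpairs_uniq; rewrite ?iota_uniq // => -[a i] [a' i'] /=.
  move=> /allpairsP[[? ?] /= [+ _ [-> ->]]] /allpairsP[[? ?] /= [+ _ [-> ->]]].
  rewrite !mem_iota => ? ? [-> ?]; congr pair; lia.
rewrite -[LHS]/((i, j) \in shifted_rows) mem_shifted_rows.
apply/idP/allpairsP => [h|[[a i'] /= [+ + [-> ->]]]].
  exists (b i + n - j, i) => /=; rewrite !mem_iota.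
  by split; [lia | lia | congr pair; lia].
rewrite !mem_iota; lia.
Qed.

Lemma cardfs_perm (A : {fset nat * nat}) (s : seq (nat * nat)) :
  uniq s -> A =i s -> #|` A| = size s.
Proof. by move=> us As; apply/perm_size/uniq_perm. Qed.

Lemma arm_shifted_rows i a : 0 < i <= k -> a < n ->
  arm shifted_rows (i, b i + n - a) = a.
Proof.
move=> hi ha; pose s := [seq (i, j) | j <- iota (b i + n - a).+1 a].
rewrite /arm (@cardfs_perm _ s) ?size_map ?size_iota //.
  by rewrite map_inj_uniq ?iota_uniq // => ? ? [].
move=> [i' j]; rewrite !inE /= mem_shifted_rows.
apply/idP/mapP => [/and3P[h /eqP e h']|[j' + [-> ->]]]; subst.
  exists j => //; rewrite mem_iota; lia.
rewrite mem_iota eqxx; lia.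
Qed.

Lemma leg_shifted_rows i a : 0 < i <= k -> a < n ->
  leg shifted_rows (i, b i + n - a) = row_leg a i.
Proof.
move=> hi ha; pose p i' := b i <= b i' + a.
pose s := [seq (i', b i + n - a) | i' <- iota 1 i.-1 & p i'].
rewrite /leg (@cardfs_perm _ s) ?size_map ?size_filter //.
  by rewrite map_inj_uniq ?filter_uniq ?iota_uniq // => ? ? [].
move=> [i' j]; rewrite !inE /= mem_shifted_rows.
apply/idP/mapP => [/and3P[h /eqP e h']|[i0 + [-> ->]]]; subst.
  by exists i' => //; rewrite mem_filter mem_iota /p; lia.
rewrite mem_filter mem_iota /p eqxx => h.
(* The left end of row [i0] is no obstacle: it is not to the right of that of row [i], hence not
   past the column, as [a < n]. *)
have : b i0 <= b i by apply: b_mono; lia.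
lia.
Qed.

Lemma AL_shifted_rows :
  AL shifted_rows =
  seq_mset [seq (a, l) | a <- iota 0 n, l <- [seq row_leg a i | i <- iota 1 k]].
Proof.
apply/eq_seq_msetP; apply: perm_trans (perm_map _ perm_shifted_rows) _.
rewrite map_allpairs allpairs_mapr.
suff /eq_in_allpairs -> : {in iota 0 n & iota 1 k,
    (fun a i => (arm shifted_rows (i, b i + n - a),
                 leg shifted_rows (i, b i + n - a)))
    =2 (fun a i => (a, row_leg a i))} by [].
move=> a i; rewrite !mem_iota => ha hi.
by rewrite arm_shifted_rows ?leg_shifted_rows //; lia.
Qed.

(** As [b] is nondecreasing, the rows that count toward the leg are consecutive and lie directly
    below row [i]. *)
Lemma leq_row_leg a i d : 0 < d -> i <= k ->
  (d <= row_leg a i) = (d < i) && (b i <= b (i - d) + a).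
Proof.
move=> d_gt0 hi; case: i hi => [|i] hi; first by rewrite /row_leg /=; lia.
rewrite leq_count_iota // => i1 i2 h1 h2 h3 /leq_trans -> //.
by rewrite leq_add2r b_mono //; lia.
Qed.

End Shifted.

(** The reversal [k.+1 - i] keeps the distance of two rows, and complementing to [c] keeps the
    difference of their shifts. *)
Lemma perm_row_leg_rev k b b' c a :
  (forall i j, 0 < i -> i <= j -> j <= k -> b i <= b j) ->
  (forall i, 0 < i <= k -> b i + b' (k.+1 - i) = c) ->
  perm_eq [seq row_leg b a i | i <- iota 1 k] [seq row_leg b' a i | i <- iota 1 k].
Proof.
move=> b_mono bb'; have b'_mono i j : 0 < i -> i <= j -> j <= k -> b' i <= b' j.
  move=> i_gt0 ij jk; have := b_mono (k.+1 - j) (k.+1 - i).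
  have := bb' (k.+1 - j); have := bb' (k.+1 - i); rewrite !subKn; lia.
apply: perm_eq_count_leq => -[|d].
  by rewrite !(@eq_count _ (leq 0) predT) // !count_predT !size_map.
pose q (f : nat -> nat) i := f i <= f (i - d.+1) + a.
(* Only rows above row [d.+1] can have leg length at least [d.+1]. *)
pose r := iota d.+2 (k - d.+1).
have countE f : (forall i j, 0 < i -> i <= j -> j <= k -> f i <= f j) ->
    count (leq d.+1) [seq row_leg f a i | i <- iota 1 k] = count (q f) r.
  move=> f_mono; rewrite count_map -!size_filter; apply/perm_size/uniq_perm.
  - by rewrite filter_uniq ?iota_uniq.
  - by rewrite filter_uniq ?iota_uniq.
  move=> i; rewrite !mem_filter !mem_iota /=.
  have [ik|ik] := leqP i k; last by rewrite /q; lia.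
  rewrite (leq_row_leg f_mono) // /q; lia.
(* Reversal sends the rows [i - d.+1] and [i] to [k + d.+2 - i] and [k.+1 - i]; the former is the
   new upper row. *)
have rev_r : perm_eq r [seq k + d.+2 - i | i <- r].
  apply: uniq_perm; rewrite ?iota_uniq ?map_inj_in_uniq ?iota_uniq //.
    by move=> i j; rewrite !mem_iota; lia.
  move=> i; rewrite mem_iota; apply/idP/mapP => [h|[j + ->]].
    by exists (k + d.+2 - i); rewrite ?mem_iota; lia.
  rewrite mem_iota; lia.
rewrite !countE // (permP rev_r) count_map; apply: eq_in_count => i.
rewrite mem_iota /q /= => hi.
have := bb' (k + d.+2 - i); have := bb' (k + d.+2 - i - d.+1).
have -> : k.+1 - (k + d.+2 - i) = i - d.+1 by lia.
have -> : k.+1 - (k + d.+2 - i - d.+1) = i by lia.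
lia.
Qed.

Theorem theorem1p3 (n k : nat) (alpha : nat -> nat)
    (hn : 0 < n) (hk : 0 < k)
    (halpha1 : alpha 1 <= n)
    (hdec : forall i : nat, 1 <= i < k -> alpha i.+1 <= alpha i) :
  AL (skewT n k alpha) = AL (skewTstar n k alpha).
Proof.
have mono i j : 0 < i -> i <= j -> j <= k -> alpha j <= alpha i.
  move=> i_gt0 /subnK <-; elim: (j - i) => [|d IHd] hd //=.
  by apply: leq_trans (hdec _ _) (IHd _); lia.
pose b i := alpha 1 - alpha i; pose b' i := alpha (k - i + 1) - alpha k.
rewrite -[skewT n k alpha]/(shifted_rows n k b).
rewrite -[skewTstar n k alpha]/(shifted_rows n k b').
rewrite !AL_shifted_rows.
- apply/eq_seq_msetP/perm_allpairs_dep => // a _.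
  (* The constant is the sum of [alpha 1 - alpha i] and [alpha i - alpha k]. *)
  apply: (@perm_row_leg_rev _ _ _ (alpha 1 - alpha k)) => [i j *|i hi].
    by rewrite leq_sub2l ?mono.
  rewrite /b /b'; have -> : k - (k.+1 - i) + 1 = i by lia.
  by have := mono 1 i; have := mono i k; lia.
- by move=> i j *; rewrite leq_sub2r ?mono; lia.
- by move=> i j *; rewrite leq_sub2l ?mono.
Qed.
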